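(* Let $(G,\cdot)$ be an S-quasigroup. If $(H,\ast)$ is an S-loop which is S-isotopic to $(G,\cdot)$, then there exist S-elements $f$ and $g$ such that $(H,\ast)$ is S-isomorphic to a Smarandache $f,g$-principal isotope $(G,\circ)$ of $(G,\cdot)$.
   Context: A groupoid is a non-empty set with a binary operation. A quasigroup is a groupoid $(L,\cdot)$ in which each of the equations $a\cdot x=b$ and $y\cdot a=b$ has a unique solution; a loop is a quasigroup with a two-sided identity element. An S-quasigroup (S-loop) is a quasigroup (loop) $(L,\cdot)$ having at least one non-trivial subset $M\subset L$ (a proper subset with more than one element) such that $(M,\cdot)$ is a group; such an $M$ is called an S-subgroup. Maps are written on the right. In a quasigroup $(G,\cdot)$, the translations are $yL_x=x\cdot y$ and $yR_x=y\cdot x$. An isotopism $(U,V,W):(L,\cdot)\to(K,\circ)$ is a triple of bijections $L\to K$ with $xU\circ yV=(x\cdot y)W$ for all $x,y\in L$. For S-quasigroups or S-loops with S-subgroups $L'\subset L$, $K'\subset K$, the isotopism is an S-isotopism if $(L')A=K'$ for every $A\in\{U,V,W\}$; the structures are S-isotopic if an S-isotopism exists (for some S-subgroups $L',K'$). An S-isotopism with $U=V=W$ is an S-isomorphism, and then the structures are called S-isomorphic. A Smarandache $f,g$-principal isotopism of an S-quasigroup $(G,\cdot)$ with S-subgroup $G'$ is an S-isotopism of the form $(R_g,L_f,I):(G,\cdot)\to(G,\circ)$ (with respect to $G'$, with $I$ the identity map and $R_g,L_f$ the translations of $(G,\cdot)$) where $f,g\in G'$; thus $(x\cdot g)\circ(f\cdot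 y)=x\cdot y$ for all $x,y\in G$. Then $f,g$ are called S-elements and $(G,\circ)$ is called a Smarandache $f,g$-principal isotope of $(G,\cdot)$. *)

(* Defs.v *)
From mathcomp Require Import all_boot.
From mathcomp Require Import boolp classical_sets.
Set Implicit Arguments.
Unset Strict Implicit.
Unset Printing Implicit Defensive.
Local Open Scope classical_set_scope.

(* Structures are presented by a binary operation on an arbitrary, possibly
   infinite, type.  Maps, written on the right in the source, are ordinary
   functions here: x U is U x, and the image (M)U is U @` M. *)

Definition quasigroup (L : Type) (op : L -> L -> L) : Prop :=
  [/\ inhabited L,
      forall a b : L, exists! x : L, op a x = b
    & forall a b : L, exists! y : L, op y a = b].

Definition loop (L : Type) (op : L -> L -> L) : Prop :=
  quasigroup op /\
  exists e : L, forall x : L, op e x = x /\ op x e = x.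

(* The identity of the group (M, op) is not assumed to be an identity of L. *)
Definition group_on (L : Type) (op : L -> L -> L) (M : set L) : Prop :=
  [/\ forall x y, M x -> M y -> M (op x y),
      forall x y z, M x -> M y -> M z -> op x (op y z) = op (op x y) z
    & exists e, [/\ M e,
        forall x, M x -> op e x = x /\ op x e = x
      & forall x, M x -> exists y, [/\ M y, op x y = e & op y x = e]]].

Definition S_subgroup (L : Type) (op : L -> L -> L) (M : set L) : Prop :=
  [/\ M `<` [set: L],
      exists x y, [/\ M x, M y & x <> y]
    & group_on op M].

Definition S_quasigroup (L : Type) (op : L -> L -> L) : Prop :=
  quasigroup op /\ exists M : set L, S_subgroup op M.

Definition S_loop (L : Type) (op : L -> L -> L) : Prop :=
  loop op /\ exists M : set L, S_subgroup op M.

Definition Ltrans (L : Type) (op : L -> L -> L) (x : L) : L -> L :=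
  fun y => op x y.

Definition Rtrans (L : Type) (op : L -> L -> L) (x : L) : L -> L :=
  fun y => op y x.

Definition isotopism (L K : Type) (opL : L -> L -> L) (opK : K -> K -> K)
    (U V W : L -> K) : Prop :=
  [/\ bijective U, bijective V, bijective W
    & forall x y : L, opK (U x) (V y) = W (opL x y)].

Definition S_isotopism (L K : Type)
    (opL : L -> L -> L) (L' : set L) (opK : K -> K -> K) (K' : set K)
    (U V W : L -> K) : Prop :=
  [/\ quasigroup opL /\ S_subgroup opL L',
      quasigroup opK /\ S_subgroup opK K',
      isotopism opL opK U V W
    & [/\ U @` L' = K', V @` L' = K' & W @` L' = K']].

Definition S_isotopic (L K : Type)
    (opL : L -> L -> L) (opK : K -> K -> K) : Prop :=
  exists (L' : set L) (K' : set K) (U V W : L -> K),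
    S_isotopism opL L' opK K' U V W.

Definition S_isomorphism (L K : Type)
    (opL : L -> L -> L) (L' : set L) (opK : K -> K -> K) (K' : set K)
    (U : L -> K) : Prop :=
  S_isotopism opL L' opK K' U U U.

Definition S_isomorphic (L K : Type)
    (opL : L -> L -> L) (opK : K -> K -> K) : Prop :=
  exists (L' : set L) (K' : set K) (U : L -> K),
    S_isomorphism opL L' opK K' U.

(* The target S-subgroup is again G' because the third component is id. *)
Definition S_principal_isotopism (G : Type) (op : G -> G -> G) (G' : set G)
    (f g : G) (circ : G -> G -> G) : Prop :=
  [/\ G' f, G' g
    & S_isotopism op G' circ G' (Rtrans op g) (Ltrans op f) id].

Definition S_principal_isotope (G : Type) (op : G -> G -> G)
    (f g : G) (circ : G -> G -> G) : Prop :=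
  exists G' : set G, S_principal_isotopism op G' f g circ.

(* Main.v *)
Require Import Defs.
From mathcomp Require Import all_boot.
From mathcomp Require Import boolp classical_sets.

(** Let (U, V, W) be an S-isotopism from the loop H to G, carrying the
    S-subgroup H' to G', and let e be the identity of H.  Setting one argument
    to e in [U x . V y = W (x * y)] gives [U x . V e = W x] and
    [U e . V y = W y]: with f = U e and g = V e, the translations of G satisfy
    R_g U = W and L_f V = W (maps composed from right to left).  Hence
    (U, V, W) is the composite of (W, W, W) with the inverse of (R_g, L_f, I).
    So the operation circ obtained by carrying the product of H to G along W is
    at once isomorphic to H through W and the f,g-principal isotope of G.

    The Smarandache part rests on [loop_id_in_subgroup]: H' contains e, whence
    f and g lie in G'.  That circ is a quasigroup with S-subgroup G' = W(H') is
    transport of structure ([quasigroup_transport], [S_subgroup_transport]). *)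

Set Implicit Arguments.
Unset Strict Implicit.

Local Open Scope classical_set_scope.

(** The identity c of the group M solves [c * x = c], and so does e; the
    solution being unique, e = c. *)
Lemma loop_id_in_subgroup (L : Type) (op : L -> L -> L) (M : set L) (e : L) :
  quasigroup op -> (forall x, op x e = x) -> group_on op M -> M e.
Proof.
move=> [_ hl _] he [_ _ [c [Mc idc _]]].
have [z [_ uz]] := hl c c.
by rewrite -(uz e (he c)) (uz c (idc c Mc).1).
Qed.

Lemma quasigroup_transport (L K : Type) (opL : L -> L -> L)
    (opK : K -> K -> K) (W : L -> K) :
  bijective W -> {morph W : x y / opL x y >-> opK x y} ->
  quasigroup opL -> quasigroup opK.
Proof.
move=> [W' WK W'K] hW [[x0] hl hr]; split; first by exists; exact: W x0.
- move=> a b; have [x [hx ux]] := hl (W' a) (W' b).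
  exists (W x); split; first by rewrite -[a]W'K -hW hx W'K.
  move=> y hy; rewrite -[y]W'K; congr W; apply: ux.
  by apply: (can_inj WK); rewrite hW !W'K.
- move=> a b; have [x [hx ux]] := hr (W' a) (W' b).
  exists (W x); split; first by rewrite -[a]W'K -hW hx W'K.
  move=> y hy; rewrite -[y]W'K; congr W; apply: ux.
  by apply: (can_inj WK); rewrite hW !W'K.
Qed.

Lemma group_on_transport (L K : Type) (opL : L -> L -> L)
    (opK : K -> K -> K) (W : L -> K) (M : set L) :
  {morph W : x y / opL x y >-> opK x y} ->
  group_on opL M -> group_on opK (W @` M).
Proof.
move=> hW [cl ass [e [Me ide inve]]]; split.
- by move=> _ _ [x Mx <-] [y My <-]; exists (opL x y); [exact: cl | exact: hW].
- move=> _ _ _ [x Mx <-] [y My <-] [z Mz <-].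
  by rewrite -!hW ass.
- exists (W e); split; first by exists e.
  + by move=> _ [x Mx <-]; have [ex xe] := ide x Mx; rewrite -!hW ex xe.
  + move=> _ [x Mx <-]; have [y [My xy yx]] := inve x Mx.
    by exists (W y); split; [exists y | rewrite -hW xy | rewrite -hW yx].
Qed.

Lemma S_subgroup_transport (L K : Type) (opL : L -> L -> L)
    (opK : K -> K -> K) (W : L -> K) (M : set L) :
  bijective W -> {morph W : x y / opL x y >-> opK x y} ->
  S_subgroup opL M -> S_subgroup opK (W @` M).
Proof.
move=> bW hW [[_ pM] [x [y [Mx My xy]]] gM].
have injW := bij_inj bW.
split; last exact: group_on_transport gM.
- split=> // full; apply: pM => z _.
  by have [z' Mz' /injW <-] := full (W z) I.
- exists (W x), (W y); split; [by exists x | by exists y |].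
  by move=> /injW.
Qed.

Lemma bijective_factor (A B C : Type) (U : A -> B) (W : A -> C) (T : B -> C) :
  bijective U -> bijective W -> (forall x, T (U x) = W x) -> bijective T.
Proof.
move=> [U' UK U'K] bW TU.
apply: (@eq_bij _ _ (W \o U')); last by move=> y /=; rewrite -TU U'K.
by apply: bij_comp => //; exists U.
Qed.

Lemma image_factor (A B C : Type) (U : A -> B) (W : A -> C) (T : B -> C)
    (M : set A) :
  (forall x, T (U x) = W x) -> T @` (U @` M) = W @` M.
Proof. by move=> TU; rewrite image_comp; apply: eq_imagel => x _; exact: TU. Qed.

Theorem theorem4p2 (G H : Type) (mul : G -> G -> G) (star : H -> H -> H)
    (hG : S_quasigroup mul) (hH : S_loop star)
    (hiso : S_isotopic star mul) :
  exists (f g : G) (circ : G -> G -> G),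
    S_principal_isotope mul f g circ /\ S_isomorphic star circ.
Proof.
have [[_ [e ide]] _] := hH.
have [H' [G' [U [V [W [[qH sH] [qG sG] [bU bV bW hUVW] [UG VG WG]]]]]]] := hiso.
have H'e : H' e.
  by case: sH => _ _; apply: loop_id_in_subgroup => // x; case: (ide x).
have RU x : Rtrans mul (V e) (U x) = W x by rewrite /Rtrans hUVW (ide x).2.
have LV y : Ltrans mul (U e) (V y) = W y by rewrite /Ltrans hUVW (ide y).1.
have [W' WK W'K] := bW.
pose circ a b := W (star (W' a) (W' b)).
have hW : {morph W : x y / star x y >-> circ x y}.
  by move=> x y; rewrite /circ !WK.
have qC : quasigroup circ := quasigroup_transport bW hW qH.
have sC : S_subgroup circ G' by rewrite -WG; exact: S_subgroup_transport sH.
exists (U e), (V e), circ; split; last first.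
  by exists H', G', W; split=> //; split=> // x y; rewrite hW.
exists G'; split; [by rewrite -UG; exists e | by rewrite -VG; exists e |].
split=> //.
- split; [exact: bijective_factor RU | exact: bijective_factor LV |
          by exists id |].
  move=> x y; have [[U' _ U'K] [V' _ V'K]] := (bU, bV).
  by rewrite -[x]U'K -[y]V'K RU LV -hW -hUVW.
- split; last exact: image_id.
  + by rewrite -[in LHS]UG (image_factor _ RU).
  + by rewrite -[in LHS]VG (image_factor _ LV).
Qed.
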